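(* Let $X_0\in\mathbb{R}^{n\times p_0}$ and $X\in\mathbb{R}^{n\times p}$ be such that the columns of $(X_0,X)$ are linearly independent and $X_0'X=0_{p_0\times p}$, and suppose $n>p+p_0$. Let $Y\in\mathbb{R}^n$ be such that $\mathsf{SSE}>0$ and $\mathsf{SSR}>0$, where $$\widehat\beta=(X'X)^{-1}X'Y,\qquad \mathsf{SSE}=Y'(I_n-\mathsf{P}_{X_0}-\mathsf{P}_X)Y,\qquad \mathsf{SSR}=\widehat\beta'X'X\widehat\beta .$$ For a positive definite $p\times p$ matrix $W$, let $m_W(Y)$ denote the marginal likelihood $$m_W(Y)=\frac{\Gamma\left(\frac{n-p_0}{2}\right)\pi^{-(n-p_0)/2}}{\left(|X'X|\,|X_0'X_0|\,|(X'X)^{-1}+W|\right)^{1/2}}\left[\mathsf{SSE}+\widehat\beta'[W+(X'X)^{-1}]^{-1}\widehat\beta\right]^{-\frac{n-p_0}{2}} .$$ Then the solution of the optimization problem $$\text{maximize } m_W(Y)\quad\text{subject to } W\succeq n(X'X)^{-1}$$ (over symmetric $p\times p$ matrices $W$) is $$\widehat W=a\,\widehat\beta\widehat\beta'+n(X'X)^{-1},\qquad a=\max\left\{0,\ \frac{n-p_0-1}{\mathsf{SSE}}-\frac{n+1}{\mathsf{SSR}}\right\}.$$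
   Context: A prime denotes transpose, $|\cdot|$ denotes the determinant, and $A\succeq B$ means that $A-B$ is positive semidefinite. $\mathsf{P}_X=X(X'X)^{-1}X'$ and $\mathsf{P}_{X_0}=X_0(X_0'X_0)^{-1}X_0'$. The function $m_W(Y)$ is the marginal likelihood of the normal linear model $Y=X_0\beta_0+X\beta+\epsilon$, $\epsilon\sim N_n(0_n,\sigma^2I_n)$, with prior $\pi(\beta_0,\sigma^2)\propto 1/\sigma^2$ on $(\beta_0,\sigma^2)$ and $\beta\mid\sigma^2\sim N_p(0_p,\sigma^2W)$: $$m_W(Y)=\int_{\mathbb{R}_+}\int_{\mathbb{R}^p}\int_{\mathbb{R}^{p_0}}N_n(Y\mid X_0\beta_0+X\beta,\sigma^2I_n)\,N_p(\beta\mid 0_p,\sigma^2W)\,\frac{1}{\sigma^2}\,\mathrm d\beta_0\,\mathrm d\beta\,\mathrm d\sigma^2,$$ where $N_k(\cdot\mid\mu,\Sigma)$ is the $k$-dimensional normal density. The closed form given in the claim can be taken as the definition of $m_W(Y)$. *)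

(* Defs.v *)
From mathcomp Require Import all_boot all_order all_algebra.
From mathcomp Require Import all_classical all_reals all_analysis.

Set Implicit Arguments.
Unset Strict Implicit.
Unset Printing Implicit Defensive.

Import Order.TTheory GRing.Theory Num.Theory.
Import numFieldNormedType.Exports.

Local Open Scope classical_set_scope.
Local Open Scope ring_scope.

(* Euler's integral; equal to Gamma(a) for 0 < a, and a junk value when the
   integral diverges. *)
Definition gamma_fun (R : realType) (a : R) : R :=
  \int[@lebesgue_measure R]_(t in `]0, +oo[) (t `^ (a - 1) * expR (- t)).

Definition psdmx (R : realType) (p : nat) (A : 'M[R]_p) : Prop :=
  A^T = A /\ forall v : 'cV[R]_p, 0 <= (v^T *m A *m v) 0 0.

Definition argmax_on (R : realType) (T : Type) (D : set T) (f : T -> R) :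
    set T :=
  [set x | D x /\ forall y, D y -> f y <= f x].

Section LinearModel.
Variables (R : realType) (n p0 p : nat).
Variables (X0 : 'M[R]_(n, p0)) (X : 'M[R]_(n, p)) (Y : 'cV[R]_n).

(* Orthogonal projection onto the column space of a matrix of full column
   rank. *)
Definition proj_col (q : nat) (Z : 'M[R]_(n, q)) : 'M[R]_n :=
  Z *m invmx (Z^T *m Z) *m Z^T.

Definition beta_hat : 'cV[R]_p := invmx (X^T *m X) *m X^T *m Y.

Definition SSE : R :=
  (Y^T *m (1%:M - proj_col X0 - proj_col X) *m Y) 0 0.

Definition SSR : R := (beta_hat^T *m (X^T *m X) *m beta_hat) 0 0.

(* Marginal likelihood, in closed form, of Y = X0 b0 + X b + e with
   e ~ N(0, s2 I), b | s2 ~ N(0, s2 W) and prior density 1 / s2 on (b0, s2),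
   for X0^T *m X = 0 and W positive definite. *)
Definition marginal_likelihood (W : 'M[R]_p) : R :=
  gamma_fun ((n%:R - p0%:R) / 2) * pi `^ (- ((n%:R - p0%:R) / 2))
  / (\det (X^T *m X) * \det (X0^T *m X0)
     * \det (invmx (X^T *m X) + W)) `^ (1 / 2)
  * (SSE + (beta_hat^T *m invmx (W + invmx (X^T *m X)) *m beta_hat) 0 0)
      `^ (- ((n%:R - p0%:R) / 2)).

End LinearModel.

(* Main.v *)
Require Import Defs.
From mathcomp Require Import all_boot all_order all_algebra.
From mathcomp Require Import all_classical all_reals all_analysis.
From mathcomp Require Import measurable_realfun ring lra zify.

Import Order.TTheory GRing.Theory Num.Theory.
Import numFieldNormedType.Exports.

Set Implicit Arguments.
Unset Strict Implicit.
Unset Printing Implicit Defensive.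

Local Open Scope classical_set_scope.
Local Open Scope ring_scope.

(* Write W + (X'X)^-1 = M + P with M = (n + 1) (X'X)^-1 and P positive
   semidefinite, and let b be the least squares estimate. Decomposing P into
   rank-one terms v v', each of them can only increase
   det M * (b' M^-1 b), by the Cauchy-Schwarz inequality for M^-1, and leaves it
   unchanged only when v is proportional to b. Hence for a given value u of
   b' (M + P)^-1 b the determinant is smallest exactly when P = t b b', and the
   problem reduces to minimizing (SSE + u)^(n - p0) / u over
   0 < u <= SSR / (n + 1), which Bernoulli's inequality solves. *)

(** * Positivity of the Gamma integral *)

(** For t > 1, t^s is at most t^m with m the integer after the floor of s, and (t/2)^m / m! is a
    term of the series of exp(t/2). The summand 1 covers t <= 1. *)
Lemma powR_le_expR_half (R : realType) (s t : R) : 0 <= s -> 0 < t ->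
  t `^ s <= (1 + 2 ^+ (Num.truncn s).+1 * ((Num.truncn s).+1)`!%:R) * expR (t / 2).
Proof.
move=> s0 t0; set m := (Num.truncn s).+1.
have e1 : 1 <= expR (t / 2) by rewrite -expR0 ler_expR divr_ge0// ltW.
have f0 : (0 : R) < m`!%:R by rewrite ltr0n fact_gt0.
have p0 : (0 : R) < 2 ^+ m by rewrite exprn_gt0.
rewrite mulrDl mul1r; have [t1|t1] := lerP t 1.
  apply: (@le_trans _ _ 1); last by rewrite ler_wpDr// !mulr_ge0 ?expR_ge0 ?ltW.
  have := @ge0_ler_powR _ s s0 t 1; rewrite powR1 !nnegrE; apply=> //.
  exact: ltW.
apply: (@le_trans _ _ (t ^+ m)).
  rewrite -powR_mulrn ?(ltW t0)//; apply: ler_powR; first exact: ltW.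
  exact/ltW/Num.Theory.truncnS_gt.
apply: ler_wpDl; first exact: expR_ge0.
have := @expR_ge1Dxn R (t / 2) (Num.truncn s) (ltW (divr_gt0 t0 (ltr0Sn _ 1))).
rewrite -/m expr_div_n => h.
have mf : 0 < 2 ^+ m * m`!%:R :> R by rewrite mulr_gt0.
rewrite -ler_pdivrMl//; apply: (le_trans _ h).
by rewrite mulrC invfM mulrA ler_wpDl.
Qed.

Lemma gamma_fun_gt0 (R : realType) (a : R) : 1 <= a -> 0 < gamma_fun a.
Proof.
move=> a1; rewrite /gamma_fun.
set D : set R := `]0, +oo[%classic; set mu := @lebesgue_measure R.
set f := fun t : R => t `^ (a - 1) * expR (- t).
have mf (E : set (measurableTypeR R)) :
    measurable_fun E (EFin \o f : measurableTypeR R -> \bar R).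
  apply/measurable_EFinP/measurable_funTS/measurable_funM => //.
  by apply: measurableT_comp => //.
have f0 (t : R) : (0 <= (f t)%:E)%E by rewrite lee_fin mulr_ge0 ?powR_ge0 ?expR_ge0.
have mD : measurable (D : set (measurableTypeR R)) by exact: measurable_itv.
have intf : mu.-integrable D (EFin \o f).
  (* The factor 2 cancels the rate 1/2 in the dominating exponential density. *)
  set m := (Num.truncn (a - 1)).+1; set C : R := 2 * (1 + 2 ^+ m * m`!%:R).
  apply: (@le_integrable _ _ _ mu D _ _
    (fun t => C%:E * (exponential_pdf (2^-1) t)%:E)%E) => //.
  - move=> t; rewrite /D/= in_itv/= andbT => t0; rewrite lee_fin.
    have C0 : 0 <= C by rewrite mulr_ge0// addr_ge0// mulr_ge0// exprn_ge0.
    rewrite ger0_norm; last by rewrite -lee_fin f0.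
    rewrite ger0_norm; last by rewrite mulr_ge0 ?exponential_pdf_ge0.
    rewrite exponential_pdfE ?(ltW t0)// /C mulrACA divff// mul1r.
    have a10 : 0 <= a - 1 by rewrite subr_ge0.
    apply: (le_trans (ler_wpM2r (expR_ge0 _) (powR_le_expR_half a10 t0))).
    rewrite -mulrA -expRD; have -> // : t / 2 - t = - 2^-1 * t by field.
  - apply: integrableZl => //.
    apply: (@integrableS _ _ _ mu setT) => //.
    exact: integrable_exponential_pdf.
(* The real integral is [fine] of an extended one, hence 0 if that is infinite: finiteness is needed
   besides the lower bound e^-2 coming from [1, 2]. *)
rewrite fine_gt0// integrable_lty// andbT.
have h : ((expR (- 2))%:E <= \int[mu]_(t in D) (f t)%:E)%E.
  apply: (@le_trans _ _ (\int[mu]_(t in `[1%R, 2%R]) (f t)%:E)%E); last first.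
    apply: ge0_subset_integral => //.
    by apply: subset_itv; rewrite bnd_simp.
  apply: (@le_trans _ _ (\int[mu]_(t in `[1%R, 2%R]) (cst (expR (-2))%:E t))%E).
    rewrite integral_cst//= lebesgue_measure_itv/= lte_fin ltr1n.
    have e21 : 2 - 1 = 1 :> R by ring.
    by rewrite -EFinB -EFinM lee_fin e21 mulr1.
  apply: ge0_le_integral => //.
  - by move=> t; rewrite lee_fin expR_ge0.
  - move=> t /=; rewrite in_itv/= => /andP[t1 t2].
    rewrite lee_fin /f -[leLHS]mul1r ler_pM ?expR_ge0//;
      last by rewrite ler_expR lerN2.
    by rewrite -[leLHS](powRr0 t) ler_powR// subr_ge0.
by apply: lt_le_trans h; rewrite lte_fin expR_gt0.
Qed.

(** * Positive definite matrices and Cholesky factors *)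

Definition pdmx (R : realType) (p : nat) (A : 'M[R]_p) : Prop :=
  A^T = A /\ forall v : 'cV[R]_p, v != 0 -> 0 < (v^T *m A *m v) 0 0.

(** Induction splitting off the first row and column: a zero pivot [a] forces [r = 0], a positive
    one leaves a positive semidefinite Schur complement. *)
Lemma psdmx_cholesky (R : realType) (p : nat) (A : 'M[R]_p) :
  psdmx A -> exists L : 'M[R]_p, A = L *m L^T.
Proof.
elim: p A => [|p IH] A.
  by move=> _; exists 0; apply/matrixP => -[].
rewrite -[A](@submxK _ 1 p 1 p).
set a := @ulsubmx _ 1 p 1 p A; set r := @ursubmx _ 1 p 1 p A.
set c := @dlsubmx _ 1 p 1 p A; set D := @drsubmx _ 1 p 1 p A.
rewrite [a]mx11_scalar; move: (a 0 0) => {}a.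
case=> /= sA qA.
move: sA; rewrite (@tr_block_mx _ 1 p 1 p) => E.
have [_ _ cr sD] := @eq_block_mx _ 1 p 1 p _ _ _ _ _ _ _ _ E; move=> {E}.
move: qA; rewrite -{}cr => qA.
have q (x : R) (v : 'cV[R]_p) :
    0 <= a * x ^+ 2 + 2 * x * (r *m v) 0 0 + (v^T *m D *m v) 0 0.
  have := qA (@col_mx _ 1 p 1 x%:M v).
  rewrite (@tr_col_mx _ 1 p) (@mul_row_block _ 1 1 p 1 p) (@mul_row_col _ 1 1 p).
  rewrite tr_scalar_mx !mulmxDl -!mulmxA !mul_scalar_mx.
  have -> : (v^T *m (r^T *m x%:M)) = x *: (r *m v).
    by rewrite mul_mx_scalar -scalemxAr -trmx_mul [r *m v]mx11_scalar tr_scalar_mx.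
  have -> : r *m v = ((r *m v) 0 0)%:M by rewrite -mx11_scalar.
  rewrite !mxE !eqxx /= !mulr1n; lra.
have a0 : 0 <= a.
  by have := q 1 0; rewrite !mulmx0 !mxE; lra.
have [az|an] := eqVneq a 0.
  have rv0 (v : 'cV[R]_p) : (r *m v) 0 0 = 0.
    apply/eqP/negPn/negP => rv; set w := (r *m v) 0 0 in rv.
    (* With [a = 0] the form is affine in [x], and this [x] would give it the value -1. *)
    have := q (- ((v^T *m D *m v) 0 0 + 1) / (2 * w)) v.
    rewrite az mul0r add0r -/w; set d := (v^T *m D *m v) 0 0.
    have -> : 2 * (- (d + 1) / (2 * w)) * w = - (d + 1) by field.
    by lra.
  have r0 : r = 0.
    apply/rowP => j; have := rv0 (delta_mx j 0).
    by rewrite -colE !mxE.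
  have [L' DL] : exists L' : 'M[R]_p, D = L' *m L'^T.
    apply: IH; split => // v; have := q 0 v; lra.
  exists (@block_mx _ 1 p 1 p 0 0 0 L').
  rewrite (@tr_block_mx _ 1 p 1 p) !trmx0 (@mulmx_block _ 1 p 1 p 1 p)
    !(mulmx0, mul0mx, addr0, add0r) -DL r0 az.
  by rewrite trmx0 raddf0.
have {an}a0 : 0 < a by rewrite lt_neqAle eq_sym an.
have [L' DL] : exists L' : 'M[R]_p, D - a^-1 *: (r^T *m r) = L' *m L'^T.
  apply: IH; split.
    by rewrite linearB/= linearZ/= trmx_mul trmxK sD.
  (* This [x] minimizes the quadratic; the minimum is the form of the Schur complement at [v]. *)
  move=> v; have := q (- a^-1 * (r *m v) 0 0) v.
  have -> : v^T *m (D - a^-1 *: (r^T *m r)) *m v =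
      v^T *m D *m v - a^-1 *: ((r *m v)^T *m (r *m v)).
    by rewrite mulmxBr mulmxBl -scalemxAr -scalemxAl trmx_mul !mulmxA.
  set u := r *m v; have -> : u^T *m u = (u 0 0 ^+ 2)%:M.
    by apply/matrixP => i j; rewrite !ord1 !mxE big_ord1 !mxE.
  move: (u 0 0) => w; rewrite !mxE eqxx mulr1n.
  have -> : a * (- a^-1 * w) ^+ 2 = a^-1 * w ^+ 2 by field; rewrite gt_eqF.
  by lra.
exists (@block_mx _ 1 p 1 p (Num.sqrt a)%:M 0 ((Num.sqrt a)^-1 *: r^T) L').
rewrite (@tr_block_mx _ 1 p 1 p) !trmx0 (@mulmx_block _ 1 p 1 p 1 p)
  !(mulmx0, mul0mx, addr0, add0r) -DL.
rewrite tr_scalar_mx -scalar_mxM -expr2 sqr_sqrtr ?(ltW a0)//.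
have s0 : Num.sqrt a != 0 by rewrite gt_eqF// sqrtr_gt0.
rewrite linearZ /= trmxK mul_scalar_mx mul_mx_scalar !scalerA divff// !scale1r.
rewrite -scalemxAl -scalemxAr scalerA -invfM -expr2 sqr_sqrtr ?(ltW a0)//.
by rewrite addrC subrK.
Qed.

Lemma pdmx_unit (R : realType) (p : nat) (A : 'M[R]_p) :
  pdmx A -> A \in unitmx.
Proof.
case=> _ A0; rewrite -row_free_unit; apply: inj_row_free => v vA.
apply/eqP/negPn/negP => v0; have := A0 v^T.
rewrite -trmx0 (inj_eq trmx_inj) trmxK vA mul0mx mxE ltxx.
by move/(_ v0).
Qed.

Lemma pdmx_psd (R : realType) (p : nat) (A : 'M[R]_p) : pdmx A -> psdmx A.
Proof.
case=> sA A0; split=> // v; have [->|v0] := eqVneq v 0.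
  by rewrite mulmx0 mxE.
exact/ltW/A0.
Qed.

Lemma pdmx_det_gt0 (R : realType) (p : nat) (A : 'M[R]_p) :
  pdmx A -> 0 < \det A.
Proof.
move=> pdA; have [L AL] := psdmx_cholesky (pdmx_psd pdA).
rewrite lt_neqAle eq_sym -unitfE -unitmxE (pdmx_unit pdA) /=.
by rewrite AL det_mulmx det_tr -expr2 sqr_ge0.
Qed.

Lemma pdmx_inv (R : realType) (p : nat) (A : 'M[R]_p) :
  pdmx A -> pdmx (invmx A).
Proof.
move=> pdA; have uA := pdmx_unit pdA; case: pdA => sA A0.
split=> [|v v0]; first by rewrite trmx_inv sA.
have := A0 (invmx A *m v).
rewrite trmx_mul trmx_inv sA -!mulmxA mulKVmx// !mulmxA; apply.
by apply: contra_neq v0 => Av; rewrite -(mulKVmx uA v) Av mulmx0.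
Qed.

Lemma pdmxD (R : realType) (p : nat) (A B : 'M[R]_p) :
  pdmx A -> psdmx B -> pdmx (A + B).
Proof.
move=> [sA A0] [sB B0]; split=> [|v v0]; first by rewrite linearD/= sA sB.
by rewrite mulmxDr mulmxDl mxE ltr_wpDr// A0.
Qed.

Lemma pdmxZ (R : realType) (p : nat) (c : R) (A : 'M[R]_p) :
  0 < c -> pdmx A -> pdmx (c *: A).
Proof.
move=> c0 [sA A0]; split=> [|v v0]; first by rewrite linearZ/= sA.
by rewrite -scalemxAr -scalemxAl mxE mulr_gt0// A0.
Qed.

Lemma gram_row_free_pdmx (R : realType) (n p : nat) (X : 'M[R]_(n, p)) :
  row_free X^T -> pdmx (X^T *m X).
Proof.
move=> fX; split=> [|v v0]; first by rewrite trmx_mul trmxK.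
have Xv : X *m v != 0.
  apply: contra_neq v0 => Xv; apply/trmx_inj/(row_free_inj fX).
  by rewrite /= -trmx_mul Xv !trmx0 mul0mx.
rewrite mulmxA -trmx_mul -mulmxA mxE.
under eq_bigr do rewrite mxE -expr2.
have ge0 i : true -> 0 <= (X *m v) i 0 ^+ 2 by rewrite sqr_ge0.
rewrite lt_neqAle eq_sym sumr_ge0// andbT.
apply: contra_neq Xv => /eqP; rewrite psumr_eq0// => /allP Xv.
apply/colP => i; rewrite [RHS]mxE; apply/eqP.
by have := Xv i (mem_index_enum i); rewrite sqrf_eq0.
Qed.

Lemma psdmx_rank1 (R : realType) (p : nat) (v : 'cV[R]_p) : psdmx (v *m v^T).
Proof.
split=> [|w]; first by rewrite trmx_mul trmxK.
rewrite mulmxA -mulmxA -[w^T *m v]trmxK trmx_mul trmxK mxE big_ord1.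
by rewrite !mxE -expr2 sqr_ge0.
Qed.

(** * Rank-one updates of the determinant and of the inverse *)

(** The block matrix with rows (1, -B) and (A, 1) factors both as lower times upper and as upper
    times lower triangular; each factorization yields one side. *)
Lemma det1D_mulmxC (R : comNzRingType) (m n : nat)
    (A : 'M[R]_(m, n)) (B : 'M[R]_(n, m)) :
  \det (1%:M + A *m B) = \det (1%:M + B *m A).
Proof.
have <- : \det (block_mx 1%:M 0 A 1%:M *m block_mx 1%:M (- B) 0 (1%:M + A *m B))
    = \det (1%:M + A *m B).
  by rewrite det_mulmx det_lblock det_ublock !det1 !mul1r.
have -> : block_mx 1%:M 0 A 1%:M *m block_mx 1%:M (- B) 0 (1%:M + A *m B)
    = block_mx (1%:M + B *m A) (- B) 0 1%:M *m block_mx 1%:M 0 A 1%:M.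
  rewrite !mulmx_block !(mulmx0, mul0mx, mulmx1, mul1mx, addr0, add0r).
  by rewrite mulmxN mulNmx addrK addrCA addNr addr0.
by rewrite det_mulmx det_lblock det_ublock !det1 !mulr1.
Qed.

Lemma det_rank1_update (R : comUnitRingType) (p : nat) (A : 'M[R]_p)
    (u v : 'cV[R]_p) : A \in unitmx ->
  \det (A + u *m v^T) = \det A * (1 + (v^T *m invmx A *m u) 0 0).
Proof.
move=> uA; have -> : A + u *m v^T = A *m (1%:M + (invmx A *m u) *m v^T).
  by rewrite mulmxDr mulmx1 !mulmxA mulmxV// mul1mx.
by rewrite det_mulmx det1D_mulmxC det_mx11 mxE [_%:M _ _]mxE eqxx mulr1n mulmxA.
Qed.

Definition qform (R : realType) (p : nat) (A : 'M[R]_p) (u v : 'cV[R]_p) : R :=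
  (u^T *m A *m v) 0 0.

Section QuadraticForm.
Variables (R : realType) (p : nat).
Implicit Types (A M : 'M[R]_p) (b u v w : 'cV[R]_p).

Lemma qformC A u v : A^T = A -> qform A u v = qform A v u.
Proof.
move=> sA; rewrite /qform; transitivity ((u^T *m A *m v)^T 0 0).
  by rewrite [RHS]mxE.
by rewrite !trmx_mul trmxK sA mulmxA.
Qed.

Lemma qform_mulmx A u v : qform A u v = qform 1%:M u (A *m v).
Proof. by rewrite /qform mulmx1 mulmxA. Qed.

Lemma qformBZr A u v w (x y : R) :
  qform A u (x *: v - y *: w) = x * qform A u v - y * qform A u w.
Proof. by rewrite /qform mulmxBr -!scalemxAr !mxE. Qed.

(* With [z = A(b,b) v - A(b,v) b], the defect of the Cauchy-Schwarz inequality is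
   [A(z,z) / A(b,b)]. *)
Lemma pdmx_CauchySchwarz A b v : pdmx A ->
  qform A b v ^+ 2 <= qform A b b * qform A v v ?= iff
    (qform A b b *: v == qform A b v *: b).
Proof.
move=> [sA A0]; have [->|b0] := eqVneq b 0.
  apply/leifP; rewrite scaler0 /qform trmx0 !mul0mx !mxE scale0r eqxx.
  by rewrite expr0n mul0r.
have bb0 : 0 < qform A b b by exact: A0.
set z := qform A b b *: v - qform A b v *: b.
have zz : qform A z z =
    qform A b b * (qform A b b * qform A v v - qform A b v ^+ 2).
  rewrite {2}/z qformBZr ![qform A z _]qformC// !qformBZr.
  by rewrite [qform A v b]qformC//; ring.
rewrite -subr_eq0 -/z; have [z0|z0] := eqVneq z 0.
  apply/leifP; rewrite eq_sym -subr_eq0.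
  move/eqP: zz; rewrite z0 {1}/qform mulmx0 mxE eq_sym mulf_eq0.
  by rewrite gt_eqF.
apply/leifP; rewrite -subr_gt0 -(pmulr_rgt0 _ bb0) -zz.
exact: A0.
Qed.

(** This is the Sherman-Morrison formula evaluated at [b]. *)
Lemma qform_inv_rank1_update M b v : M^T = M -> M \in unitmx ->
  M + v *m v^T \in unitmx ->
  qform (invmx (M + v *m v^T)) b b =
    qform (invmx M) b b
    - qform (invmx M) b v ^+ 2 / (1 + qform (invmx M) v v).
Proof.
move=> sM uM uM'; have sV : (invmx M)^T = invmx M by rewrite trmx_inv sM.
have al0 : 1 + qform (invmx M) v v != 0.
  apply: contraTneq uM' => al0; rewrite unitmxE det_rank1_update//.
  by rewrite -/(qform _ _ _) al0 mulr0 unitr0.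
set g := qform (invmx M) b v; set al := qform (invmx M) v v in al0 *.
(* An explicit solution of the linear system is checked; the scalar [1] gives it the shape of
   [qformBZr]. *)
have E : (M + v *m v^T) *m
    (1 *: (invmx M *m b) - (g / (1 + al)) *: (invmx M *m v)) = b.
  have vM w : v *m v^T *m (invmx M *m w) = qform (invmx M) v w *: v.
    by rewrite -mulmxA (mulmxA v^T) [v^T *m _ *m _]mx11_scalar mul_mx_scalar//.
  rewrite scale1r mulmxBr -scalemxAr !mulmxDl !mulKVmx// !vM.
  rewrite [qform _ v b]qformC// -/g -/al.
  rewrite -[X in X + al *: v]scale1r -scalerDl scalerA divfK//.
  by rewrite addrK.
have {}E : invmx (M + v *m v^T) *m b
    = 1 *: (invmx M *m b) - (g / (1 + al)) *: (invmx M *m v).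
  by rewrite -[in LHS]E mulKmx.
rewrite [LHS]qform_mulmx E qformBZr -!qform_mulmx -/g mul1r.
by rewrite expr2 mulrAC.
Qed.

End QuadraticForm.

(** * Determinant times inverse form under semidefinite increments *)

(** At [W + (X'X)^-1] and the least squares estimate, this is the term added to [SSE] in the
    likelihood. *)
Definition qinv (R : realType) (p : nat) (M : 'M[R]_p) (b : 'cV[R]_p) : R :=
  qform (invmx M) b b.

Section RankOneIncrements.
Variables (R : realType) (p : nat).
Implicit Types (M P : 'M[R]_p) (b v : 'cV[R]_p).

Lemma qinv_gt0 M b : pdmx M -> b != 0 -> 0 < qinv M b.
Proof. by move=> pdM b0; case: (pdmx_inv pdM) => _; apply. Qed.

(** The determinant gains the factor [1 + al] that Sherman-Morrison divides by, so the product grows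
    by [det M] times the Cauchy-Schwarz defect [qinv M b * al - g ^+ 2]. *)
Lemma det_qinv_rank1 M b v : pdmx M -> b != 0 ->
  [/\ \det M * qinv M b <= \det (M + v *m v^T) * qinv (M + v *m v^T) b,
      qinv (M + v *m v^T) b <= qinv M b
    & \det (M + v *m v^T) * qinv (M + v *m v^T) b = \det M * qinv M b ->
      exists s : R, v = s *: b].
Proof.
move=> pdM b0; have pdM' := pdmxD pdM (psdmx_rank1 v).
have [uM uM'] := (pdmx_unit pdM, pdmx_unit pdM').
have d0 := pdmx_det_gt0 pdM; have pdV := pdmx_inv pdM.
have be0 := qinv_gt0 pdM b0.
have -> : qinv (M + v *m v^T) b = qinv M b
    - qform (invmx M) b v ^+ 2 / (1 + qform (invmx M) v v).
  by apply: qform_inv_rank1_update => //; case: pdM.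
rewrite det_rank1_update// -/(qform _ _ _).
have [CS CSe] := pdmx_CauchySchwarz b v pdV.
rewrite -/(qinv M b) in CS CSe *.
set al := qform (invmx M) v v in CS CSe *.
set g := qform (invmx M) b v in CS CSe *.
have al0 : 0 <= al by case: (pdmx_psd pdV) => _; apply.
have al1 : 0 < 1 + al by rewrite ltr_wpDr.
have E : \det M * (1 + al) * (qinv M b - g ^+ 2 / (1 + al))
    = \det M * (qinv M b + (qinv M b * al - g ^+ 2)).
  by field; rewrite gt_eqF.
rewrite E ler_pM2l// lerDl subr_ge0; split=> //.
  by rewrite lerBlDr lerDl divr_ge0// ?sqr_ge0// ltW.
move/(mulfI (lt0r_neq0 d0))/eqP.
rewrite -subr_eq0 addrAC subrr add0r subr_eq0 eq_sym.
rewrite CSe => /eqP vb; exists ((qinv M b)^-1 * g).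
by rewrite -scalerA -vb scalerA mulVf ?scale1r// gt_eqF.
Qed.

(** The base matrix absorbs one term per induction step. No step lowers the product, so overall
    equality forces equality at each step and makes every [v i] a multiple of [b]. *)
Lemma det_qinv_sum (I : Type) (r : seq I) (v : I -> 'cV[R]_p) M b :
  pdmx M -> b != 0 -> let M' := M + \sum_(i <- r) v i *m (v i)^T in
  [/\ pdmx M', \det M * qinv M b <= \det M' * qinv M' b, qinv M' b <= qinv M b
    & \det M' * qinv M' b = \det M * qinv M b ->
      exists2 t : R, 0 <= t & M' = M + t *: (b *m b^T)].
Proof.
move=> + b0; elim: r M => [|i r IH] M pdM /=.
  rewrite big_nil addr0; split=> // _; exists 0 => //.
  by rewrite scale0r addr0.
rewrite big_cons addrA; set M1 := M + v i *m (v i)^T.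
have [h1 g1 e1] := det_qinv_rank1 (v i) pdM b0.
have [pd' h2 g2 e2] := IH M1 (pdmxD pdM (psdmx_rank1 _)).
split=> //; [exact: le_trans h2|exact: le_trans g1|move=> e].
have e' : \det M1 * qinv M1 b = \det M * qinv M b.
  by apply/le_anti; rewrite h1 -e h2.
have [s vs] := e1 e'; have [t t0 ->] := e2 (etrans e (esym e')).
exists (s ^+ 2 + t); first by rewrite addr_ge0 ?sqr_ge0.
rewrite /M1 vs linearZ/= -scalemxAl -scalemxAr scalerA -expr2 scalerDl.
by rewrite addrA.
Qed.

Lemma psdmx_sum_rank1 P : psdmx P ->
  exists v : 'I_p -> 'cV[R]_p, P = \sum_i v i *m (v i)^T.
Proof.
case/psdmx_cholesky => L ->; exists (fun i => col i L).
apply/matrixP => i j; rewrite summxE mxE; apply: eq_bigr => k _.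
by rewrite !mxE big_ord1 !mxE.
Qed.

Lemma det_qinv_psd M P b : pdmx M -> psdmx P -> b != 0 ->
  [/\ \det M * qinv M b <= \det (M + P) * qinv (M + P) b,
      qinv (M + P) b <= qinv M b
    & \det (M + P) * qinv (M + P) b = \det M * qinv M b ->
      exists2 t : R, 0 <= t & P = t *: (b *m b^T)].
Proof.
move=> pdM /psdmx_sum_rank1[v ->] b0.
have [_ h g e] := det_qinv_sum (index_enum 'I_p) v pdM b0.
split=> // /e[t t0 /addrI]; by exists t.
Qed.

(** The increment is the rank-one term of [Num.sqrt t *: b]. The factors [1 + t * qinv M b] cancel
    in the product, so the whole ray attains the lower bound. *)
Lemma det_qinv_ray M b (t : R) : pdmx M -> 0 <= t ->
  \det (M + t *: (b *m b^T)) = \det M * (1 + t * qinv M b) /\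
  qinv (M + t *: (b *m b^T)) b = qinv M b / (1 + t * qinv M b).
Proof.
move=> pdM t0; have tb : t *: (b *m b^T) = (Num.sqrt t *: b) *m (Num.sqrt t *: b)^T.
  by rewrite linearZ/= -scalemxAl -scalemxAr scalerA -expr2 sqr_sqrtr.
have pdM' := pdmxD pdM (psdmx_rank1 (Num.sqrt t *: b)).
have [uM uM'] := (pdmx_unit pdM, pdmx_unit pdM').
have [sM _] := pdM; have [sV V0] := pdmx_psd (pdmx_inv pdM).
have bv : qform (invmx M) b (Num.sqrt t *: b) = Num.sqrt t * qinv M b.
  by rewrite /qinv /qform -scalemxAr mxE.
have vv : qform (invmx M) (Num.sqrt t *: b) (Num.sqrt t *: b) = t * qinv M b.
  rewrite /qform -scalemxAr mxE -/(qform _ _ _) qformC// bv.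
  by rewrite mulrA -expr2 sqr_sqrtr.
rewrite tb det_rank1_update// -/(qform _ _ _) vv; split=> //.
rewrite {1}/qinv qform_inv_rank1_update// vv bv exprMn sqr_sqrtr// -/(qinv M b).
have : 1 + t * qinv M b != 0.
  by rewrite gt_eqF// ltr_wpDr// mulr_ge0//; exact: V0.
by move=> ?; field.
Qed.

End RankOneIncrements.

(** * Bernoulli's inequality and the minimization *)

(** Both sides agree at exponent 1, so the induction starts at exponent 2, where the gap is (x -
    1)^2. *)
Lemma ltr_bernoulli (R : realFieldType) (x : R) (k : nat) :
  0 < x -> x != 1 -> (0 < k)%N -> 1 + k.+1%:R * (x - 1) < x ^+ k.+1.
Proof.
move=> x0 x1; elim: k => // k IH _.
have sq : 0 < (x - 1) ^+ 2 by rewrite lt_neqAle eq_sym sqrf_eq0 subr_eq0 x1 sqr_ge0.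
case: k IH => [_|k IH]; first by rewrite expr2; nra.
have := IH isT; rewrite -(ltr_pM2l x0) -exprS; apply: le_lt_trans.
have k0 : 0 <= k.+2%:R * (x - 1) ^+ 2 by rewrite mulr_ge0// ltW.
by rewrite -[k.+3%:R]natr1; nra.
Qed.

(** This compares (s + u)^(k+1) / u at [u] and [u0]. The sign hypothesis is first-order optimality
    of [u0] in the direction of [u], at an interior minimum or at an endpoint; Bernoulli for the
    ratio [x] makes it global. *)
Lemma ltr_exprD_ratio (R : realFieldType) (s u u0 : R) (k : nat) :
  0 < s -> 0 < u -> 0 < u0 -> (0 < k)%N ->
  u != u0 -> 0 <= (u - u0) * (k%:R * u0 - s) ->
  (s + u0) ^+ k.+1 * u < (s + u) ^+ k.+1 * u0.
Proof.
move=> s0 u_gt0 u0_gt0 k0 uu0 h.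
have su : 0 < s + u by lra.
have su0 : 0 < s + u0 by lra.
set x := (s + u) / (s + u0).
have xE : s + u = x * (s + u0) by rewrite /x divfK// gt_eqF.
have x0 : 0 < x by rewrite divr_gt0.
have x1 : x != 1.
  by apply: contra_neq uu0 => x1; move: xE; rewrite x1 mul1r => /addrI.
rewrite [X in X ^+ _ * u0]xE exprMn mulrAC mulrC ltr_pM2r ?exprn_gt0//.
rewrite -ltr_pdivrMr//; apply: le_lt_trans (ltr_bernoulli x0 x1 k0).
rewrite -subr_ge0.
have -> : 1 + k.+1%:R * (x - 1) - u / u0
    = (u - u0) * (k%:R * u0 - s) / (u0 * (s + u0)).
  by rewrite /x -natr1; field; rewrite !gt_eqF.
by rewrite divr_ge0// ltW// mulr_gt0.
Qed.

(* Parametrized by [D = det (M + P)] and [u = b^T (M + P)^-1 b], the constraint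
   is [D * u >= det M * b^T M^-1 b], so that [D * (s + u) ^+ k.+1] is bounded
   below by a multiple of [(s + u) ^+ k.+1 / u], minimal at [s / k] on the
   positive reals; the maximum with [0] in [a] is the constraint
   [u <= b^T M^-1 b]. *)
Lemma det_qinv_minimizer (R : realType) (p : nat) (M P : 'M[R]_p)
    (b : 'cV[R]_p) (s : R) (k : nat) :
  pdmx M -> psdmx P -> b != 0 -> 0 < s -> (0 < k)%N ->
  let a := Num.max 0 (k%:R / s - (qinv M b)^-1) in
  let f Q := \det (M + Q) * (s + qinv (M + Q) b) ^+ k.+1 in
  f (a *: (b *m b^T)) <= f P ?= iff (P == a *: (b *m b^T)).
Proof.
move=> pdM psP b0 s0 k0 a f; rewrite {}/f.
have q0 := qinv_gt0 pdM b0; have d0 := pdmx_det_gt0 pdM.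
have pdMP := pdmxD pdM psP.
have u_gt0 := qinv_gt0 pdMP b0; have D0 := pdmx_det_gt0 pdMP.
have [h uq e] := det_qinv_psd pdM psP b0.
have a0 : 0 <= a by rewrite le_max lexx.
have [dA uA] := det_qinv_ray b pdM a0.
have kR0 : 0 < k%:R :> R by rewrite ltr0n.
have aq0 : 0 < 1 + a * qinv M b by rewrite ltr_wpDr// mulr_ge0// ltW.
have u0_gt0 : 0 < qinv (M + a *: (b *m b^T)) b by rewrite uA divr_gt0.
have DuA : \det (M + a *: (b *m b^T)) * qinv (M + a *: (b *m b^T)) b
    = \det M * qinv M b.
  by rewrite dA uA mulrACA -mulrA mulrA divff ?mulr1// gt_eqF.
(* If [a = 0], the candidate has the largest admissible value [qinv M b], which is at most [s / k],
   and both factors are nonpositive. Otherwise [a] makes its value exactly [s / k]. *)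
have opt : 0 <= (qinv (M + P) b - qinv (M + a *: (b *m b^T)) b)
    * (k%:R * qinv (M + a *: (b *m b^T)) b - s).
  rewrite uA; case: (leP (k%:R / s - (qinv M b)^-1) 0) => ka.
    have az : a = 0 by rewrite /a max_l.
    rewrite az mul0r addr0 divr1 mulr_le0// subr_le0//.
    by move: ka; rewrite subr_le0 ler_pdivrMr// mulrC ler_pdivlMr.
  have -> : k%:R * (qinv M b / (1 + a * qinv M b)) - s = 0; last by rewrite mulr0.
  have aE : a = k%:R / s - (qinv M b)^-1 by rewrite /a max_r// ltW.
  have -> : 1 + a * qinv M b = k%:R * qinv M b / s.
    by rewrite aE; field; rewrite !gt_eqF.
  by field; rewrite !gt_eqF.
set A := a *: (b *m b^T) in dA uA u0_gt0 DuA opt *.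
(* For equal inverse forms only the determinants can differ; their equality puts [P] on the ray of
   [b *m b^T], where the form determines the coefficient. *)
have [uu|uu] := eqVneq (qinv (M + P) b) (qinv (M + A) b).
  have DD : \det (M + A) <= \det (M + P) by rewrite -(ler_pM2r u0_gt0) DuA -uu.
  have su0 : 0 < (s + qinv (M + A) b) ^+ k.+1 by rewrite exprn_gt0// addr_gt0.
  rewrite uu; split; first by rewrite ler_pM2r.
  rewrite (inj_eq (mulIf (lt0r_neq0 su0))); apply/eqP/eqP => [DE|-> //].
  have [t t0 Pt] : exists2 t : R, 0 <= t & P = t *: (b *m b^T).
    by apply: e; rewrite -DE uu DuA.
  have [_ ut] := det_qinv_ray b pdM t0; rewrite -Pt uu uA in ut.
  have {}ut := invr_inj (mulfI (lt0r_neq0 q0) ut).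
  by move/addrI: ut => /(mulIf (lt0r_neq0 q0)) at_eq; rewrite Pt -at_eq.
have PA : P != A by apply: contra_neq uu => ->.
apply/leifP; rewrite (negPf PA).
(* Multiplying by both inverse forms brings out the products that [h] and [DuA] compare. *)
rewrite -(ltr_pM2r u0_gt0) -(ltr_pM2r u_gt0).
apply: (@lt_le_trans _ _ (\det M * qinv M b *
    ((s + qinv (M + P) b) ^+ k.+1 * qinv (M + A) b))).
  rewrite -DuA [X in X < _](_ : _ = \det (M + A) * qinv (M + A) b *
    ((s + qinv (M + A) b) ^+ k.+1 * qinv (M + P) b)); last by ring.
  by rewrite ltr_pM2l ?DuA ?mulr_gt0// ltr_exprD_ratio.
rewrite [leRHS](_ : _ = \det (M + P) * qinv (M + P) b *
    ((s + qinv (M + P) b) ^+ k.+1 * qinv (M + A) b)); last by ring.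
by rewrite ler_wpM2r// mulr_ge0 ?(ltW u0_gt0)// exprn_ge0// addr_ge0// ltW.
Qed.

(** * The marginal likelihood and its maximizer *)

(** All dependence on [W] is gathered under one square root with a natural exponent, which turns the
    maximization into the minimization above. *)
Lemma marginal_likelihoodE (R : realType) (n p0 p k : nat)
    (X0 : 'M[R]_(n, p0)) (X : 'M[R]_(n, p)) (Y : 'cV[R]_n) (W : 'M[R]_p) :
  let S := invmx (X^T *m X) in
  n%:R - p0%:R = k%:R :> R ->
  0 <= \det (X^T *m X) * \det (X0^T *m X0) * \det (S + W) ->
  0 <= SSE X0 X Y + qinv (S + W) (beta_hat X Y) ->
  marginal_likelihood X0 X Y W =
    gamma_fun (k%:R / 2) * pi `^ (- (k%:R / 2)) /
    Num.sqrt (\det (X^T *m X) * \det (X0^T *m X0) *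
      (\det (S + W) * (SSE X0 X Y + qinv (S + W) (beta_hat X Y)) ^+ k)).
Proof.
move=> S nk d0 u0; rewrite /marginal_likelihood -/S nk [W + S]addrC.
rewrite -/(qform _ _ _) -/(qinv _ _) div1r powR12_sqrt//.
set E := SSE X0 X Y + _ in u0 *.
have -> : E `^ (- (k%:R / 2)) = (Num.sqrt (E ^+ k))^-1.
  by rewrite powRN powRrM powR_mulrn// powR12_sqrt ?exprn_ge0.
by rewrite [in RHS]mulrA [in RHS]sqrtrM// invfM mulrA.
Qed.

Theorem proposition1 (R : realType) (n p0 p : nat)
    (X0 : 'M[R]_(n, p0)) (X : 'M[R]_(n, p)) (Y : 'cV[R]_n)
    (hfree : row_free (row_mx X0 X)^T)
    (horth : X0^T *m X = 0)
    (hn : (p + p0 < n)%N)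
    (hSSE : 0 < SSE X0 X Y)
    (hSSR : 0 < SSR X Y) :
  let b := beta_hat X Y in
  let a := Num.max 0 ((n%:R - p0%:R - 1) / SSE X0 X Y
                      - (n%:R + 1) / SSR X Y) in
  argmax_on [set W : 'M[R]_p | W^T = W /\
                               psdmx (W - n%:R *: invmx (X^T *m X))]
            (marginal_likelihood X0 X Y)
  = [set a *: (b *m b^T) + n%:R *: invmx (X^T *m X)].
Proof.
move=> b a.
have b0 : b != 0.
  by apply: contraTneq hSSR => b0; rewrite /SSR -/b b0 mulmx0 mxE ltxx.
(* With [hn] this gives n - p0 >= 2, hence [0 < k] below, as strict Bernoulli requires. *)
have p_gt0 : (0 < p)%N.
  case: p X {hfree horth hn hSSE hSSR a} @b b0 => // X1 b.
  by rewrite [b]flatmx0 eqxx.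
have [pdG0 pdG] : pdmx (X0^T *m X0) /\ pdmx (X^T *m X).
  move: hfree; rewrite tr_row_mx => fX.
  split; apply: gram_row_free_pdmx; apply: inj_row_free => v vX.
    have /eq_row_mx[] // : row_mx v (0 : 'rV[R]_p) = row_mx 0 0.
    apply: (row_free_inj fX).
    by rewrite /= !mul_row_col vX !mul0mx.
  have /eq_row_mx[] // : row_mx (0 : 'rV[R]_p0) v = row_mx 0 0.
  apply: (row_free_inj fX).
  by rewrite /= !mul_row_col vX !mul0mx.
(* For W = Q + n S, the matrix S + W is M + Q, and the constraint says that Q is positive
   semidefinite. *)
set S := invmx (X^T *m X); set M := (n%:R + 1) *: S.
have pdS : pdmx S := pdmx_inv pdG.
have n1 : 0 < n%:R + 1 :> R by rewrite ltr_wpDl.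
have pdM : pdmx M := pdmxZ n1 pdS.
have qM : (qinv M b)^-1 = (n%:R + 1) / SSR X Y.
  rewrite /qinv /M invmxZ ?(pdmx_unit pdM)// invmxK /qform -scalemxAr -scalemxAl.
  by rewrite mxE invfM invrK.
(* The exponent n - p0 is [k.+1], while the numerator n - p0 - 1 in [a] is [k]. *)
pose k := (n - p0).-1.
have kE : n%:R - p0%:R = k.+1%:R :> R.
  rewrite prednK -?natrB//; first lia.
  by rewrite subn_gt0; lia.
have k0 : (0 < k)%N by rewrite /k; lia.
have aE : a = Num.max 0 (k%:R / SSE X0 X Y - (qinv M b)^-1).
  by rewrite qM /a kE -natr1 addrK.
pose f Q := \det (M + Q) * (SSE X0 X Y + qinv (M + Q) b) ^+ k.+1.
pose d := \det (X^T *m X) * \det (X0^T *m X0).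
have d0 : 0 < d by rewrite mulr_gt0// pdmx_det_gt0.
pose c : R := gamma_fun (k.+1%:R / 2) * pi `^ (- (k.+1%:R / 2)).
have c0 : 0 < c.
  rewrite mulr_gt0 ?powR_gt0 ?pi_gt0//; apply: gamma_fun_gt0.
  by rewrite ler_pdivlMr// mul1r ler_nat.
have f0 Q : psdmx Q -> 0 < f Q.
  move=> psQ; have pdMQ := pdmxD pdM psQ.
  by rewrite mulr_gt0 ?exprn_gt0 ?addr_gt0 ?pdmx_det_gt0 ?qinv_gt0.
have mE Q : psdmx Q ->
    marginal_likelihood X0 X Y (Q + n%:R *: S) = c / Num.sqrt (d * f Q).
  move=> psQ; have pdMQ := pdmxD pdM psQ.
  have SM : S + (Q + n%:R *: S) = M + Q.
    by rewrite /M scalerDl scale1r [RHS]addrC addrCA [S + _]addrC.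
  rewrite (marginal_likelihoodE kE) -/S SM// ltW// ?addr_gt0 ?qinv_gt0//.
  by rewrite mulr_gt0 ?pdmx_det_gt0.
(* The likelihood is a positive constant over the square root of [d * f], so it reverses the order
   of [f]. *)
have mle P Q : psdmx P -> psdmx Q ->
    (marginal_likelihood X0 X Y (P + n%:R *: S)
      <= marginal_likelihood X0 X Y (Q + n%:R *: S)) = (f Q <= f P).
  move=> psP psQ; have [fP fQ] := (f0 _ psP, f0 _ psQ).
  have [dfP dfQ] := (mulr_gt0 d0 fP, mulr_gt0 d0 fQ).
  rewrite !mE// ler_pM2l// lef_pV2 ?posrE ?sqrtr_gt0// ler_sqrt ?(ltW dfP)//.
  by rewrite ler_pM2l.
have fmin P : psdmx P -> f (a *: (b *m b^T)) <= f P ?= iff (P == a *: (b *m b^T)).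
  by move=> psP; rewrite aE; exact: det_qinv_minimizer.
have psA : psdmx (a *: (b *m b^T)).
  have [sB B0] := psdmx_rank1 b.
  have a0 : 0 <= a by rewrite le_max lexx.
  split=> [|v]; first by rewrite linearZ/= sB.
  by rewrite -scalemxAr -scalemxAl mxE mulr_ge0.
have sS : S^T = S by case: pdS.
apply/seteqP; split=> W /=.
  move=> [[_ psW] Wmax]; rewrite -[W](subrK (n%:R *: S)); congr (_ + _).
  (* A maximizer does at least as well as the feasible candidate, so the equality case of [fmin]
     identifies the two. *)
  apply/eqP; rewrite -(fmin _ psW).2 eq_le (fmin _ psW).1 /=.
  rewrite -(mle _ _ psA psW) [W - _ + _]subrK; apply: Wmax.
  by rewrite /= addrK linearD/= [(n%:R *: S)^T]linearZ/= sS; case: (psA) => ->.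
move=> ->; split=> [|V [_ psV]].
  by rewrite /= addrK linearD/= [(n%:R *: S)^T]linearZ/= sS; case: (psA) => ->.
by rewrite -[V](subrK (n%:R *: S)) mle// (fmin _ psV).1.
Qed.
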